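(* Let $M\ge 2$ be an integer, let $F\colon X\to X$ be the twisted baker map on $X=[-1,1]\times[0,1]^{M-1}$, and let $\mathbb K=\mathbb R$ or $\mathbb K=\mathbb C$. For any continuous function $\phi\colon X\to\mathbb R$ we have $$\lim_{n\to\infty}\frac{1}{\#\mathrm{fix}_{\mathbb K}(n)}\sum_{x\in\mathrm{fix}_{\mathbb K}(n)}\phi(x)=\int\phi\,dm.$$
   Context: Let $M\ge2$ be an integer and $X=\{(x_1,\ldots,x_M)\in\mathbb R^M\colon -1\le x_1\le 1,\ 0\le x_j\le 1 \text{ for } j=2,\ldots,M\}$. Put $X_L=\{x\in X\colon x_1<0\}$ and $X_R=\{x\in X\colon x_1\ge 0\}$. The twisted baker map $F\colon X\to X$ is $$F(x_1,\ldots,x_M)=\begin{cases}(1+2x_1,x_2,\ldots,x_M) & \text{on } X_L,\\ (1-2x_M,x_1,\ldots,x_{M-1}) & \text{on } X_R.\end{cases}$$ Let $N=\{x\in X\colon x_1=-1\}$. $JF^n(x)$ denotes the Jacobian matrix of $F^n$ at $x\in X$ with respect to the canonical basis of $\mathbb R^M$, and $\mathrm{spec}(JF^n(x))$ its set of (complex) eigenvalues. At boundary points of $X_L$ or $X_R$ derivatives are understood as one-sided derivatives: $JF(x)$ is the matrix of the linear part of the affine map defining $F$ on whichever of $X_L,X_R$ contains $x$, and $JF^n(x)=JF(F^{n-1}(x))\cdots JF(F(x))JF(x)$. For $n\ge1$ define $\mathrm{fix}(n)=\{x\in X\setminus N\colon F^n(x)=x\}$, $\mathrm{fix}_{\mathbb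 R}(n)=\{x\in\mathrm{fix}(n)\colon \mathrm{spec}(JF^n(x))\subset\mathbb R\}$, $\mathrm{fix}_{\mathbb C}(n)=\{x\in\mathrm{fix}(n)\colon \mathrm{spec}(JF^n(x))\not\subset\mathbb R\}$. The symbol $\#$ denotes cardinality, and $m$ denotes the normalized restriction of the Lebesgue measure of $\mathbb R^M$ to $X$ (so $m(X)=1$). *)

(* Defs.v *)
From HB Require Import structures.
From mathcomp Require Import all_boot all_order all_algebra.
From mathcomp Require Import complex.
From mathcomp Require Import finmap.
From mathcomp Require Import all_classical all_reals all_analysis.
From mathcomp Require Import lra.

Set Implicit Arguments.
Unset Strict Implicit.
Unset Printing Implicit Defensive.

Import Order.TTheory GRing.Theory Num.Theory.
Import numFieldNormedType.Exports.

Local Open Scope classical_set_scope.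
Local Open Scope ring_scope.

(* 'rV[R]_n with its Borel sigma-algebra; convertible to 'rV[R]_n. *)
Notation borelRV R n := (g_sigma_algebraType (@open 'rV[R]_n)).

(* The library's sigma-finite structure on [m1 \x m2] is shadowed by its
   subprobability structure, hence cannot be inferred. *)
Lemma sigma_finite_product d1 d2 (T1 : measurableType d1)
    (T2 : measurableType d2) (R : realType)
    (m1 : {sigma_finite_measure set T1 -> \bar R})
    (m2 : {sigma_finite_measure set T2 -> \bar R}) :
  sigma_finite setT (m1 \x m2)%E.
Proof.
have /sigma_finiteP[F [TF ndF Foo]] := sigma_finiteT m1.
have /sigma_finiteP[G [TG ndG Goo]] := sigma_finiteT m2.
exists (fun n => F n `*` G n).
  rewrite -setXTT TF TG predeqE => -[x y]; split.
    move=> [/= [n _ Fnx] [k _ Gky]]; exists (maxn n k) => //; split.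
    - by move: x Fnx; exact/subsetPset/ndF/leq_maxl.
    - by move: y Gky; exact/subsetPset/ndG/leq_maxr.
  by move=> [n _ []/= ? ?]; split; exists n.
move=> k; have [? ?] := Foo k; have [? ?] := Goo k.
split; first exact: measurableX.
by rewrite product_measure1E// lte_mul_pinfty// ge0_fin_numE.
Qed.

Section Lebesgue.
Variable R : realType.

Definition rV_cons n (p : measurableTypeR R * borelRV R n) : borelRV R n.+1 :=
  row_mx (\row_(_ < 1) p.1) p.2.

(* Lebesgue measure on R^n: the n-fold product of the Lebesgue measure on R.
   It is a sigma-finite measure, and [lebesgue_rV_box] below computes it on
   boxes. *)
Fixpoint lebesgue_rV n : set (borelRV R n) -> \bar R :=
  match n with
  | 0 => \d_(0 : borelRV R 0)
  | n'.+1 => pushforward (@lebesgue_measure R \x @lebesgue_rV n')%E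
                         (@rV_cons n')
  end.

Lemma rV_cons0 n p : (@rV_cons n p : 'rV[R]_n.+1) 0 ord0 = p.1.
Proof.
rewrite /rV_cons (_ : ord0 = lshift n (ord0 : 'I_1)); last exact/val_inj.
by rewrite (row_mxEl (\row_(_ < 1) p.1)) mxE.
Qed.

Lemma rV_consS n p (j : 'I_n) :
  (@rV_cons n p : 'rV[R]_n.+1) 0 (lift ord0 j) = (p.2 : 'rV_n) 0 j.
Proof.
rewrite /rV_cons (_ : lift ord0 j = rshift 1 j); last exact/val_inj.
by rewrite (row_mxEr (\row_(_ < 1) p.1)).
Qed.

Lemma rV_cons_surj n (v : 'rV[R]_n.+1) :
  rV_cons (v 0 ord0, \row_j v 0 (lift ord0 j)) = v.
Proof.
apply/rowP => i; case: (unliftP ord0 i) => [j|] ->.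
  by rewrite rV_consS mxE.
by rewrite rV_cons0.
Qed.

Lemma continuous_rV_cons n :
  continuous (fun p : R * 'rV[R]_n => (rV_cons p : 'rV[R]_n.+1)).
Proof.
move=> [a v] A [P nP sPA].
have na : nbhs a (P 0 ord0) by have := nP 0 ord0; rewrite rV_cons0.
exists (P 0 ord0, [set w : 'rV[R]_n | forall j, P 0 (lift ord0 j) (w 0 j)]).
  split => //=; exists (fun _ j => P 0 (lift ord0 j)).
    by move=> i j; rewrite ord1; have := nP 0 (lift ord0 j); rewrite rV_consS.
  by move=> w /= Pw j; exact: Pw.
move=> [b w] /= [Pb Pw]; apply: sPA => i k; rewrite ord1.
case: (unliftP ord0 k) => [j|] ->; first by rewrite rV_consS; exact: Pw.
by rewrite rV_cons0.
Qed.

Lemma open_measurable_prod (T : ptopologicalType) (W : set (R * T)) :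
  open W ->
  measurable (W : set (measurableTypeR R * g_sigma_algebraType (@open T))).
Proof.
move=> oW.
pose I (q : rat * rat) : set R := `]ratr q.1, ratr q.2[%classic.
pose V q := \bigcup_(U in [set U : set T | open U /\ I q `*` U `<=` W]) U.
have -> : W = \bigcup_q (I q `*` V q).
  apply/seteqP; split => [[a t] Wat|[a t] [q _ [/= Iqa [U [_ sU] Ut]]]]; last first.
    exact: sU.
  have [[A B] /= [nA nB] sAB] := open_nbhs_nbhs (conj oW Wat).
  have [e /= e0 seA] := nA.
  have /rat_in_itvoo[q1] : a - e < a by rewrite ltrBlDr ltrDl.
  rewrite in_itv/= => /andP[q1l q1r].
  have /rat_in_itvoo[q2] : a < a + e by rewrite ltrDl.
  rewrite in_itv/= => /andP[q2l q2r].
  exists (q1, q2) => //; split; first by rewrite /I/= in_itv/= q1r q2l.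
  exists B^°; last exact: nB.
  split; first exact: open_interior.
  move=> [b s] [/=]; rewrite /I/= in_itv/= => /andP[bl br] Bs.
  apply: sAB; split => /=; last exact: interior_subset Bs.
  apply: seA; rewrite /ball_/= ltr_distlC.
  by rewrite (lt_trans q1l bl) (lt_trans br q2r).
apply: countable_bigcupT_measurable => [|q]; first exact/countableP.
apply: measurableX; first exact: measurable_itv.
apply: sub_sigma_algebra; apply: bigcup_open => U [].
by [].
Qed.

Lemma measurable_rV_cons n : measurable_fun setT (@rV_cons n).
Proof.
have := @measurability _ _ _ (borelRV R n.+1) setT (@rV_cons n) (@open 'rV[R]_n.+1).
apply => // _ [U oU <-].
rewrite setTI; apply: open_measurable_prod.
by move/continuousP: (@continuous_rV_cons n); apply.
Qed.

Lemma continuous_measurable_borel (T U : ptopologicalType) (f : T -> U) :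
  continuous f ->
  measurable_fun setT
    (f : g_sigma_algebraType (@open T) -> g_sigma_algebraType (@open U)).
Proof.
move=> cf; have := @measurability _ _ (g_sigma_algebraType (@open T))
  (g_sigma_algebraType (@open U)) setT f (@open U).
apply => // _ [V oV <-].
rewrite setTI; apply: sub_sigma_algebra.
by move/continuousP: cf; apply.
Qed.

Lemma measurable_rV_coord n (i : 'I_n) :
  measurable_fun setT ((fun v => v 0 i) : borelRV R n -> measurableTypeR R).
Proof.
have := @measurability _ _ (borelRV R n) (measurableTypeR R) setT
  (fun v => v 0 i) (@measurable_realfun.RGenOpens.G R).
apply; first exact: measurable_realfun.RGenOpens.measurableE.
move=> _ [V [a [b ->]] <-]; rewrite setTI; apply: sub_sigma_algebra.
have /continuousP := @coord_continuous R 1 n 0 i; apply.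
exact: interval_open.
Qed.

Lemma continuous_rV_tail n :
  continuous (fun v : 'rV[R]_n.+1 => (\row_j v 0 (lift ord0 j)) : 'rV[R]_n).
Proof.
move=> v A [P nP sPA].
exists (fun i k => if unlift ord0 k is Some j then P i j else setT).
  move=> i k; case: unliftP => [j ->|_]; last exact: filterT.
  by have := nP i j; rewrite mxE ord1.
move=> w /= Pw; apply: sPA => i j; rewrite mxE.
by have := Pw 0 (lift ord0 j); rewrite liftK ord1.
Qed.

HB.instance Definition _ n :=
  isMeasurableFun.Build _ _ _ _ (@rV_cons n) (@measurable_rV_cons n).

Section step.
Variables (n : nat) (mu : {sigma_finite_measure set (borelRV R n) -> \bar R}).

Definition lebesgue_step :=
  pushforward (@lebesgue_measure R \x mu)%E (@rV_cons n).

Let step0 : lebesgue_step set0 = 0%E.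
Proof. exact: measure0. Qed.

Let step_ge0 A : (0 <= lebesgue_step A)%E.
Proof. exact: measure_ge0. Qed.

Let step_sigma_additive : semi_sigma_additive lebesgue_step.
Proof. exact: measure_semi_sigma_additive. Qed.

HB.instance Definition _ := isMeasure.Build _ _ _ lebesgue_step
  step0 step_ge0 step_sigma_additive.

Let step_sigma_finite : sigma_finite setT lebesgue_step.
Proof.
have [F FT Foo] := sigma_finite_product (@lebesgue_measure R) mu.
pose g (v : borelRV R n.+1) : measurableTypeR R * borelRV R n :=
  ((v : 'rV_n.+1) 0 ord0, \row_j (v : 'rV_n.+1) 0 (lift ord0 j)).
have mg : measurable_fun setT g.
  apply: measurable_fun_pair; first exact: measurable_rV_coord.
  exact: continuous_measurable_borel (@continuous_rV_tail n).
have gK p : g (rV_cons p) = p.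
  case: p => a v; rewrite /g rV_cons0; congr pair.
  by apply/rowP => j; rewrite mxE rV_consS.
exists (fun k => g @^-1` F k).
  by rewrite -preimage_bigcup -FT preimage_setT.
move=> k; have [mF Fk] := Foo k; split.
  by rewrite -[X in measurable X]setTI; exact: mg.
rewrite /lebesgue_step /pushforward -comp_preimage.
by rewrite (_ : preimage _ _ = F k)//; apply/seteqP; split=> p /=; rewrite gK.
Qed.

HB.instance Definition _ := Measure_isSigmaFinite.Build _ _ _ lebesgue_step
  step_sigma_finite.

End step.

Lemma lebesgue_rV_sigma_finite_measure n :
  exists mu : {sigma_finite_measure set (borelRV R n) -> \bar R},
    @lebesgue_rV n = mu.
Proof.
elim: n => [|n [mu muE]] /=; first by eexists.
by rewrite muE; exists (@lebesgue_step n mu).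
Qed.

Section instances.
Variable n : nat.

Let lebesgue_rV0 : @lebesgue_rV n set0 = 0%E.
Proof. by have [mu ->] := lebesgue_rV_sigma_finite_measure n. Qed.

Let lebesgue_rV_ge0 A : (0 <= @lebesgue_rV n A)%E.
Proof. by have [mu ->] := lebesgue_rV_sigma_finite_measure n. Qed.

Let lebesgue_rV_sigma_additive : semi_sigma_additive (@lebesgue_rV n).
Proof.
have [mu ->] := lebesgue_rV_sigma_finite_measure n.
exact: measure_semi_sigma_additive.
Qed.

HB.instance Definition _ := isMeasure.Build _ _ _ (@lebesgue_rV n)
  lebesgue_rV0 lebesgue_rV_ge0 lebesgue_rV_sigma_additive.

Let lebesgue_rV_sigma_finite : sigma_finite setT (@lebesgue_rV n).
Proof.
have [mu ->] := lebesgue_rV_sigma_finite_measure n.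
exact: sigma_finiteT.
Qed.

HB.instance Definition _ := Measure_isSigmaFinite.Build _ _ _ (@lebesgue_rV n)
  lebesgue_rV_sigma_finite.

End instances.

Definition rV_box n (a b : 'I_n -> R) : set (borelRV R n) :=
  [set v : 'rV[R]_n | forall i, a i <= v 0 i <= b i].

Lemma measurable_rV_box n (a b : 'I_n -> R) : measurable (rV_box a b).
Proof.
rewrite (_ : rV_box a b =
  \bigcap_(i in [set: 'I_n]) ((fun v : 'rV[R]_n => v 0 i) @^-1` `[a i, b i])).
  apply: fin_bigcap_measurable => // i _; rewrite -[X in measurable X]setTI.
  by apply: measurable_rV_coord => //; exact: measurable_itv.
apply/seteqP; split=> v /=.
  by move=> h i _ /=; rewrite in_itv; exact: h.
by move=> h i; have := h i I; rewrite /= in_itv.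
Qed.

Lemma lebesgue_rV_box n (a b : 'I_n -> R) : (forall i, a i <= b i) ->
  lebesgue_rV (rV_box a b) = (\prod_i (b i - a i))%:E.
Proof.
elim: n a b => [|n IH] a b ab.
  by rewrite big_ord0 /= diracE mem_set// => -[].
rewrite /= /pushforward big_ord_recl EFinM -IH//.
rewrite (_ : _ @^-1` _ = `[a ord0, b ord0] `*`
  rV_box (a \o lift ord0) (b \o lift ord0)).
  rewrite product_measure1E//; last exact: measurable_rV_box.
  congr (_ * _)%E; have := lebesgue_measure_itv `[a ord0, b ord0].
  rewrite /= lte_fin => ->.
  by case: ltgtP (ab ord0) => // ->; rewrite subrr.
apply/seteqP; split=> -[r v] /=.
  move=> h; split; first by have := h ord0; rewrite rV_cons0 in_itv.
  by move=> j; have := h (lift ord0 j); rewrite rV_consS.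
rewrite in_itv/= => -[hr hv] i; case: (unliftP ord0 i) => [j|] ->.
  by rewrite rV_consS; exact: hv.
by rewrite rV_cons0.
Qed.

End Lebesgue.

#[global] Arguments lebesgue_rV : simpl never.

(* The dimension is M = n.+2; the coordinates x_1, ..., x_M of a point
   x : 'rV[R]_n.+2 are x 0 ord0, ..., x 0 ord_max. *)
Section TwistedBaker.
Variables (R : realType) (n : nat).
Local Notation M := n.+2.
Implicit Types x : 'rV[R]_M.

Definition bakerX : set 'rV[R]_M :=
  [set x | -1 <= x 0 ord0 <= 1 /\
           forall j : 'I_M, j != ord0 -> 0 <= x 0 j <= 1].

Definition baker_affL x : 'rV[R]_M :=
  \row_i (if i == ord0 then 1 + 2 * x 0 ord0 else x 0 i).

Definition baker_affR x : 'rV[R]_M :=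
  \row_i (if i == ord0 then 1 - 2 * x 0 ord_max else x 0 (inord i.-1)).

(* The affine branch of the map at x: X_L is the part x_1 < 0 of X. Everything
   is total on R^M, but only points of X matter, by [twisted_bakerX]. *)
Definition baker_branch x : 'rV[R]_M -> 'rV[R]_M :=
  if x 0 ord0 < 0 then baker_affL else baker_affR.

Definition twisted_baker x : 'rV[R]_M := baker_branch x x.

Lemma twisted_bakerX x : bakerX x -> bakerX (twisted_baker x).
Proof.
move=> [/andP[x0l x0r] xj]; rewrite /twisted_baker /baker_branch.
have [xL|xR] := ltP; split => [|j j0]; rewrite !mxE ?eqxx.
- by apply/andP; split; lra.
- by rewrite (negbTE j0) xj.
- by have /andP[? ?] := xj ord_max isT; apply/andP; split; lra.
rewrite (negbTE j0); have [->|k0] := eqVneq (inord j.-1 : 'I_M) ord0.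
  by rewrite xR x0r.
exact: xj.
Qed.

(* Matrix, with respect to the canonical basis and acting on column vectors,
   of the linear part of the affine map f: the entry (i, j) is the i-th
   coordinate of f e_j - f 0 (lin1_mx acts on row vectors, hence the
   transpose). *)
Definition affine_jacobian (f : 'rV[R]_M -> 'rV[R]_M) : 'M[R]_M :=
  (lin1_mx (fun v => f v - f 0))^T.

Definition bakerJ x : 'M[R]_M := affine_jacobian (baker_branch x).

Fixpoint bakerJn k x : 'M[R]_M :=
  if k is k'.+1 then bakerJ (iter k' twisted_baker x) *m bakerJn k' x
  else 1%:M.

Definition spec (A : 'M[R]_M) : set R[i] :=
  [set z | eigenvalue (map_mx (real_complex R) A) z].

Definition real_spec (A : 'M[R]_M) : Prop := spec A `<=` range (real_complex R).

Definition bakerN : set 'rV[R]_M := [set x | bakerX x /\ x 0 ord0 = -1].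

Definition baker_fix k : set 'rV[R]_M :=
  [set x | (bakerX `\` bakerN) x /\ iter k twisted_baker x = x].

Definition baker_fixR k : set 'rV[R]_M :=
  [set x | baker_fix k x /\ real_spec (bakerJn k x)].

Definition baker_fixC k : set 'rV[R]_M :=
  [set x | baker_fix k x /\ ~ real_spec (bakerJn k x)].

Lemma bakerX_box :
  bakerX = rV_box (fun j : 'I_M => if j == ord0 then -1 else 0) (fun=> 1).
Proof.
apply/seteqP; split => x.
  by move=> [x0 xj] j; have [->|j0] := eqVneq j ord0; [|exact: xj].
move=> xb; split; first exact: (xb ord0).
by move=> j /negbTE j0; have := xb j; rewrite j0.
Qed.

Lemma measurable_bakerX : measurable (bakerX : set (borelRV R M)).
Proof. by rewrite bakerX_box; exact: measurable_rV_box. Qed.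

Lemma lebesgue_bakerX : lebesgue_rV (bakerX : set (borelRV R M)) = 2%:E.
Proof.
rewrite bakerX_box lebesgue_rV_box.
  rewrite big_ord_recl big1 ?mulr1 ?eqxx; first by congr EFin; lra.
  by move=> i _; rewrite /= subr0.
by move=> i; case: ifP => _; lra.
Qed.

Lemma inv_volume_ge0 :
  0 <= (fine (lebesgue_rV (bakerX : set (borelRV R M))))^-1.
Proof. by rewrite lebesgue_bakerX invr_ge0. Qed.

(* Lebesgue measure restricted to X and divided by the volume of X. *)
Definition baker_measure : {measure set (borelRV R M) -> \bar R} :=
  mscale (NngNum inv_volume_ge0) (mrestr (@lebesgue_rV R M) measurable_bakerX).

Lemma baker_measureT : baker_measure setT = 1%E.
Proof.
rewrite /baker_measure /= /mscale /= /mrestr setTI.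
by rewrite lebesgue_bakerX /= -EFinM mulVf.
Qed.

End TwistedBaker.

(* Average of phi over a finite set A (0 if A is infinite or empty: if averages
   over a sequence of sets converge to 1 for phi = 1, these sets are eventually
   finite and nonempty). *)
Definition set_average (R : realType) (T : choiceType) (A : set T)
    (phi : T -> R) : R :=
  (#|` fset_set A|%:R)^-1 * \sum_(x <- fset_set A) phi x.

(* Main.v *)
From HB Require Import structures.
Require Import Defs.
From mathcomp Require Import all_boot all_order all_algebra.
From mathcomp Require Import cyclic separable cyclotomic complex finmap.
From mathcomp Require Import all_classical all_reals all_analysis.
From mathcomp Require Import zify ring lra.

(* Code the left and right branches by false and true. The Jacobian of F^k
   along an itinerary w with r right steps is a monomial matrix over the
   rotation i -> i + r of the M coordinates, and it has real spectrum iff M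
   divides r: if M divides r it is diagonal; if not, but M divides 2r, the
   squares of its eigenvalues are negative; otherwise its spectrum is invariant
   under multiplication by the non-real number omega^r, where omega is a
   primitive M-th root of unity. Since the inverse branches contract after M
   right steps, the points of fix(k) correspond to the words w of length k with
   r > 0. Write w = u v with u of large fixed length: the point coded by w lies
   in the cylinder of u, which has measure 2^-|u| and, unless u has few right
   steps, a small diameter, while the number of right steps of v modulo M is
   asymptotically uniform as |v| tends to infinity. *)

Set Implicit Arguments.
Unset Strict Implicit.
Unset Printing Implicit Defensive.

Import Order.TTheory GRing.Theory Num.Theory.
Import numFieldNormedType.Exports.

Local Open Scope classical_set_scope.
Local Open Scope ring_scope.

(** * Averages over binary words *)

Fixpoint words k : seq (seq bool) :=
  if k is k'.+1 then map (cons false) (words k') ++ map (cons true) (words k')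
  else [:: [::]].

Lemma mem_words k u : (u \in words k) = (size u == k).
Proof.
elim: k u => [|k IH] u; first by rewrite inE size_eq0.
rewrite mem_cat; apply/orP/idP => [[] /mapP[v]|].
- by rewrite IH => /eqP <- -> /=.
- by rewrite IH => /eqP <- -> /=.
case: u => [//|[] u] /=; rewrite eqSS -IH => uk; [right|left]; exact: map_f.
Qed.

Lemma uniq_words k : uniq (words k).
Proof.
elim: k => [//|k IH] /=; rewrite cat_uniq !map_inj_uniq ?IH//=;
  try by move=> u v [].
by rewrite andbT; apply/hasPn => _ /mapP[u _ ->]; apply/negP => /mapP[].
Qed.

Section WordAverage.
Variable R : realType.
Implicit Types (f g : seq bool -> R) (h : nat -> R).

Definition wavg k f : R := 2^-1 ^+ k * \sum_(u <- words k) f u.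

Lemma wavg0 f : wavg 0 f = f [::].
Proof. by rewrite /wavg big_seq1 expr0 mul1r. Qed.

Lemma wavgS k f : wavg k.+1 f =
  (wavg k (fun u => f (false :: u)) + wavg k (fun u => f (true :: u))) / 2.
Proof. by rewrite /wavg /= big_cat !big_map exprS -mulrA -!mulrDr mulrC. Qed.

Lemma eq_wavg k f g : (forall u, size u = k -> f u = g u) ->
  wavg k f = wavg k g.
Proof.
move=> fg; congr (_ * _); rewrite big_seq [RHS]big_seq.
by apply: eq_bigr => u; rewrite mem_words => /eqP /fg.
Qed.

(** Fubini: the first k and the last l letters of a random word are independent, so prefix and
    suffix can be averaged one after the other. *)
Lemma wavg_cat k l f :
  wavg (k + l) f = wavg k (fun u => wavg l (fun v => f (u ++ v))).
Proof.
elim: k f => [|k IH] f; first by rewrite wavg0.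
by rewrite addSn !wavgS !IH.
Qed.

Lemma wavgD k f g : wavg k (fun u => f u + g u) = wavg k f + wavg k g.
Proof. by rewrite /wavg big_split mulrDr. Qed.

Lemma wavgZ k c f : wavg k (fun u => c * f u) = c * wavg k f.
Proof. by rewrite /wavg -mulr_sumr; ring. Qed.

Lemma wavgB k f g : wavg k (fun u => f u - g u) = wavg k f - wavg k g.
Proof.
rewrite -[- wavg k g]mulN1r -wavgZ -wavgD.
by apply: eq_wavg => u _; rewrite mulN1r.
Qed.

Lemma wavg_cst k c : wavg k (fun=> c) = c.
Proof.
by elim: k => [|k IH]; [rewrite wavg0|rewrite wavgS IH; field].
Qed.

Lemma ler_wavg k f g : (forall u, size u = k -> f u <= g u) ->
  wavg k f <= wavg k g.
Proof.
move=> fg; rewrite ler_wpM2l ?exprn_ge0 ?invr_ge0 ?ler0n//.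
rewrite big_seq [leRHS]big_seq.
by apply: ler_sum => u; rewrite mem_words => /eqP /fg.
Qed.

Lemma ler_norm_wavg k f : `|wavg k f| <= wavg k (fun u => `|f u|).
Proof.
rewrite normrM ger0_norm ?exprn_ge0 ?invr_ge0 ?ler0n//.
by rewrite ler_wpM2l ?exprn_ge0 ?invr_ge0 ?ler0n// ler_norm_sum.
Qed.

Definition ones (u : seq bool) : nat := count id u.

(* Markov's inequality for [2 ^ - ones u], whose average is [(3/4)^k]. *)
Lemma wavg_few_ones k m :
  wavg k (fun u => (ones u < m)%:R) <= 2 ^+ m * (3 / 4) ^+ k.
Proof.
apply: (@le_trans _ _ (wavg k (fun u => 2 ^+ m * 2^-1 ^+ ones u))).
  apply: ler_wavg => u _; case: ltnP => um; last first.
    by rewrite mulr_ge0// exprn_ge0// invr_ge0.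
  rewrite -(subnK (ltnW um)) exprD -mulrA -exprMn divff// expr1n mulr1.
  by rewrite exprn_ege1// ler1n.
rewrite wavgZ ler_wpM2l ?exprn_ge0//.
elim: k => [|k IH]; first by rewrite wavg0 expr0.
rewrite wavgS/= (_ : wavg k (fun u => _ ^+ ones (true :: u)) =
   2^-1 * wavg k (fun u => 2^-1 ^+ ones u)); last first.
  by rewrite -wavgZ; apply: eq_wavg => u _; rewrite -exprS.
have -> : wavg k (fun u => 2^-1 ^+ ones (false :: u)) =
   wavg k (fun u => 2^-1 ^+ ones u) by [].
rewrite exprS; lra.
Qed.

(* The random walk on Z/m which makes a step +1 with probability 1/2. *)
Definition shift_avg h k s : R := wavg k (fun u => h (s + ones u)%N).

Lemma shift_avgS h k s :
  shift_avg h k.+1 s = (shift_avg h k s + shift_avg h k s.+1) / 2.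
Proof.
rewrite /shift_avg wavgS; congr ((_ + _) / 2).
by apply: eq_wavg => u _; rewrite addSnnS.
Qed.

Lemma shift_avgD h k l s :
  shift_avg h (k + l) s = shift_avg (shift_avg h k) l s.
Proof.
elim: l s => [|l IH] s; first by rewrite addn0 [RHS]/shift_avg wavg0 addn0.
by rewrite addnS !shift_avgS !IH.
Qed.

Lemma shift_avg_periodic m h k : (forall s, h (s + m)%N = h s) ->
  forall s, shift_avg h k (s + m)%N = shift_avg h k s.
Proof. by move=> hm s; apply: eq_wavg => u _; rewrite addnAC hm. Qed.

(** The uniform measure on Z/m is stationary: one step averages a periodic function with its cyclic
    shift, which has the same sum over a period. *)
Lemma shift_avg_sum m h k : (forall s, h (s + m)%N = h s) ->
  \sum_(0 <= s < m) shift_avg h k s = \sum_(0 <= s < m) h s.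
Proof.
move=> hm; elim: k => [|k IH].
  by apply: eq_bigr => s _; rewrite /shift_avg wavg0 addn0.
transitivity (\sum_(0 <= s < m) (shift_avg h k s + shift_avg h k s.+1) / 2).
  by apply: eq_bigr => s _; rewrite shift_avgS.
rewrite -mulr_suml big_split /=.
have -> : \sum_(0 <= s < m) shift_avg h k s.+1 =
    \sum_(0 <= s < m) shift_avg h k s.
  have : \sum_(0 <= s < m.+1) shift_avg h k s = shift_avg h k 0%N +
      \sum_(0 <= s < m) shift_avg h k s.+1 by rewrite big_nat_recl.
  rewrite big_nat_recr//= -[X in _ + shift_avg h k X]add0n.
  by rewrite shift_avg_periodic// addrC => /addrI.
by rewrite IH; field.
Qed.

Lemma shift_avg_bounds h a b k s : (forall s, a <= h s <= b) ->
  a <= shift_avg h k s <= b.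
Proof.
move=> hab; elim: k s => [|k IH] s; first by rewrite /shift_avg wavg0 addn0.
by rewrite shift_avgS; have /andP[? ?] := IH s; have /andP[? ?] := IH s.+1; lra.
Qed.

(* After k steps, the walk started at s0 - k <= s <= s0 visits s0 with
   probability at least 2^-k. *)
Lemma shift_avg_le h a b s0 k s : (forall s, a <= h s <= b) -> h s0 = a ->
  (s <= s0 <= s + k)%N -> shift_avg h k s <= b - 2^-1 ^+ k * (b - a).
Proof.
move=> hab h0; elim: k s => [|k IH] s /andP[ss0 s0s].
  have -> : s = s0 by lia.
  by rewrite /shift_avg wavg0 addn0 h0 expr0; lra.
have ub t : shift_avg h k t <= b by have /andP[] := shift_avg_bounds k t hab.
rewrite shift_avgS exprS; have [s0k|s0k] := leqP s0 (s + k).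
  by have := IH s; rewrite ss0 s0k => /(_ isT); have := ub s.+1; lra.
by have := IH s.+1; rewrite addSnnS s0s andbT => /(_ ltac:(lia)); have := ub s;
  lra.
Qed.

Lemma periodic_mod m h : (forall s, h (s + m)%N = h s) ->
  forall s, h (s %% m)%N = h s.
Proof.
move=> hm s; rewrite {2}(divn_eq s m) addnC; elim: (s %/ m)%N => [|q IH].
  by rewrite mul0n addn0.
by rewrite mulSn addnCA addnC hm.
Qed.

Lemma periodic_min m h : (0 < m)%N -> (forall s, h (s + m)%N = h s) ->
  exists s0, forall s, h s0 <= h s.
Proof.
move=> m0 hm.
have [i _ imin] := @arg_minP _ _ 'I_m (Ordinal m0) xpredT (fun i => h i) isT.
by exists i => s; rewrite -(periodic_mod hm s) (imin (Ordinal (ltn_pmod s m0))).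
Qed.

(** Doeblin's argument: within m steps the walk from any state reaches a minimum of the current
    average with probability at least 2^-m, so each block of m steps shrinks the oscillation by the
    factor 1 - 2^-m. *)
Lemma shift_avg_osc m h k : (0 < m)%N -> (forall s, h (s + m)%N = h s) ->
  (forall s, 0 <= h s <= 1) ->
  exists a, forall s,
    a <= shift_avg h (k * m) s <= a + (1 - 2^-1 ^+ m) ^+ k.
Proof.
move=> m0 hm h01; elim: k => [|k [a IH]].
  by exists 0 => s; rewrite /shift_avg wavg0 addn0 expr0 add0r.
rewrite mulSnr; pose g := shift_avg h (k * m).
have gm : forall s, g (s + m)%N = g s by exact: shift_avg_periodic.
have [s0 g0] := periodic_min m0 gm.
have /andP[p0 p1] : 0 < (2^-1 : R) ^+ m <= 1.
  by rewrite exprn_gt0 ?invr_gt0//= exprn_ile1 ?invr_ge0// invf_le1// ler1n.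
set c := 1 - 2^-1 ^+ m in IH *.
have gab s : g s0 <= g s <= a + c ^+ k.
  by rewrite g0; have /andP[] := IH s.
exists (g s0) => s; rewrite shift_avgD -/g.
have /andP[-> _] := shift_avg_bounds m s gab; rewrite /=.
(* This is the distance from s up to s0 modulo m, since s + s * (m - 1) is a multiple of m. *)
pose d := ((s0 + s * m.-1) %% m)%N.
have dm : (d < m)%N by exact: ltn_pmod.
have gd : g (s + d)%N = g s0.
  rewrite -(periodic_mod gm) modnDmr addnCA -mulnS prednK// addnC modnMDl.
  exact: periodic_mod.
have := shift_avg_le (s := s) (k := m) gab gd; rewrite leq_addr leq_add2l.
move=> /(_ (ltnW dm)) /le_trans; apply.
have -> : a + c ^+ k - 2^-1 ^+ m * (a + c ^+ k - g s0) =
  g s0 + c * (a + c ^+ k - g s0) by rewrite /c; ring.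
have /andP[ga _] := IH s0.
by rewrite lerD2l exprS ler_wpM2l; [|rewrite /c; lra|rewrite -/g in ga; lra].
Qed.

(** The averages after k0 * m steps lie in a short interval. Further steps stay in it, and so does
    the mean over a period, which the walk preserves by [shift_avg_sum]. *)
Lemma shift_avg_cvg m h : (0 < m)%N -> (forall s, h (s + m)%N = h s) ->
  (forall s, 0 <= h s <= 1) -> forall e, 0 < e ->
  \forall k \near \oo, forall s,
    `|shift_avg h k s - m%:R^-1 * \sum_(0 <= i < m) h i| <= e.
Proof.
move=> m0 hm h01 e e0.
have /andP[p0 p1] : 0 < (2^-1 : R) ^+ m <= 1.
  by rewrite exprn_gt0 ?invr_gt0//= exprn_ile1 ?invr_ge0// invf_le1// ler1n.
have c1 : `|1 - 2^-1 ^+ m : R| < 1 by rewrite ger0_norm; lra.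
have /cvgrPdist_le/(_ _ e0)[k0 _ /(_ k0 (leqnn _))] := cvg_expr c1.
rewrite sub0r normrN => ek0.
have [a ha] := shift_avg_osc k0 m0 hm h01.
have mR : (m%:R : R) != 0 by rewrite pnatr_eq0 -lt0n.
exists (k0 * m)%N => // k /= k0k s; rewrite -(subnKC k0k).
move: (k - k0 * m)%N => l.
have hb t := shift_avg_bounds l t ha.
have mean : a <= m%:R^-1 * \sum_(0 <= i < m) h i <= a + (1 - 2^-1 ^+ m) ^+ k0.
  rewrite -(shift_avg_sum (k0 * m + l) hm).
  under eq_bigr do rewrite shift_avgD.
  have cm b : \sum_(0 <= i < m) b = b * m%:R.
    by rewrite sumr_const_nat subn0 mulr_natr.
  rewrite mulrC ler_pdivlMr ?ltr0n// ler_pdivrMr ?ltr0n// -!cm.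
  by rewrite !ler_sum//= => i _; have /andP[] := hb i.
rewrite shift_avgD; have /andP[? ?] := hb s; have /andP[? ?] := mean.
have := ler_norm ((1 - 2^-1 ^+ m : R) ^+ k0).
by rewrite ler_norml; lra.
Qed.

End WordAverage.

(** * Spectra of the Jacobians *)

Section Spectrum.
Variables (R : realType) (n : nat).
Local Notation M := n.+2.
Implicit Types x : 'rV[R]_M.

Fixpoint itin k x : seq bool :=
  if k is k'.+1 then (0 <= x 0 ord0) :: itin k' (twisted_baker x) else [::].

Lemma size_itin k x : size (itin k x) = k.
Proof. by elim: k x => //= k IH x; rewrite IH. Qed.

Lemma itinSr k x :
  itin k.+1 x = rcons (itin k x) (0 <= iter k (@twisted_baker R n) x 0 ord0).
Proof.
elim: k x => [//|k IH] x.
by rewrite -[LHS]/(_ :: itin k.+1 (twisted_baker x)) IH iterSr.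
Qed.

Lemma ones_rcons u b : ones (rcons u b) = (ones u + b)%N.
Proof. by rewrite /ones -cats1 count_cat /= addn0. Qed.

Local Notation toC := (map_mx (real_complex R)).

(** [eigenvalue] refers to row vectors, hence the Jacobians are described by their action from the
    right on rows. *)
Lemma mul_jacobianL (v : 'rV[R[i]]_M) j :
  (v *m toC (affine_jacobian (@baker_affL R n))) 0 j =
  (if j == ord0 then 2 else 1 : R)%:C%C * v 0 j.
Proof.
rewrite mxE (bigD1 j)//= big1 => [|i ij]; rewrite !mxE !eqxx/=.
  rewrite addr0 mulrC; congr (_%:C%C * _).
  by case: eqVneq => _ /=; lra.
by case: ifP ij => [/eqP ->|_] /negbTE ->; rewrite ?mulr0 ?addr0 subrr mulr0.
Qed.

Lemma mul_jacobianR (v : 'rV[R[i]]_M) j :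
  (v *m toC (affine_jacobian (@baker_affR R n))) 0 j =
  (if j == ord_max then -2 else 1 : R)%:C%C * v 0 (ordS j).
Proof.
rewrite mxE (bigD1 (ordS j))//= big1 => [|i ij]; rewrite !mxE !eqxx/=.
  rewrite addr0 mulrC; congr (_%:C%C * _).
  case: (eqVneq j ord_max) => [->|jm].
    have -> : ordS ord_max = ord0 :> 'I_M by apply/val_inj; rewrite /= modnn.
    rewrite !eqxx /=; lra.
  have jM : (j.+1 < M)%N.
    by rewrite ltn_neqAle ltn_ord andbT eqSS; apply: contra jm => /eqP e;
      apply/eqP/val_inj.
  have -> : ordS j == ord0 = false by apply/eqP => /(congr1 val);
    rewrite /= modn_small.
  rewrite modn_small//= inord_val eqxx /=; lra.
case: (eqVneq i ord0) ij => [->|i0] ij.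
  have -> : ord_max == j = false.
    apply/eqP => jm; move/eqP: ij; apply; apply/val_inj.
    by rewrite -jm /= modnn.
  by rewrite !(mulr0,subr0) subrr mulr0.
have -> : (inord i.-1 == j) = false; last by rewrite subrr mulr0.
apply/eqP => ij'; move/eqP: ij; apply; apply/val_inj.
have i1 : (0 < i)%N by rewrite lt0n; apply: contra i0 => /eqP e;
  apply/eqP/val_inj.
by rewrite -ij' /= inordK ?prednK ?modn_small//; have := ltn_ord i; lia.
Qed.

(** A right step moves the index cyclically by one and contributes -2 exactly when the index wraps
    from [ord_max] to 0; the quotient by M counts these wraps. A left step keeps the index and
    contributes 1 or 2. The powers of 2 are collected in c. *)
Lemma mul_bakerJn k x : exists2 c : 'I_M -> R, (forall j, 0 < c j) &
  forall (v : 'rV[R[i]]_M) j, (v *m toC (bakerJn k x)) 0 j =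
  ((-1) ^+ ((j + ones (itin k x)) %/ M) * c j)%:C%C *
    v 0 (inord ((j + ones (itin k x)) %% M)).
Proof.
elim: k => [|k [c c0 IH]].
  exists (fun=> 1) => // v j.
  rewrite map_mx1 mulmx1 /= addn0 divn_small// modn_small// inord_val.
  by rewrite expr0 !mul1r.
rewrite itinSr ones_rcons; set s := ones _ in IH *.
have sM j : ((j + s) %% M < M)%N by rewrite ltn_pmod.
rewrite [bakerJn _ _]/= /bakerJ /baker_branch ltNge; case: (0 <= _) => /=.
  exists (fun j => c j * (if ((j + s) %% M == n.+1)%N then 2 else 1)).
    by move=> j; rewrite mulr_gt0//; case: ifP.
  move=> v j; rewrite map_mxM mulmxA IH mul_jacobianR mulrA -rmorphM /=.
  set q := (_ %/ _)%N; set t := (_ %% M)%N; have tM : (t < M)%N := sM j.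
  rewrite -val_eqE /= inordK// addnA addn1.
  have E : (j + s).+1 = (q * M + t.+1)%N by rewrite addnS -divn_eq.
  have [tn|tn] := eqVneq t n.+1.
    have -> : ((j + s).+1 %/ M = q.+1)%N.
      by rewrite E tn divnMDl// divnn addn1.
    have -> : ((j + s).+1 %% M = 0)%N by rewrite E tn -mulSnr modnMl.
    congr (_%:C%C * v 0 _); first by rewrite mulrN exprS mulN1r mulNr mulrA.
    by apply/val_inj; rewrite /= !inordK// tn modnn.
  have tM' : (t.+1 < M)%N by rewrite ltn_neqAle tM andbT eqSS.
  have -> : ((j + s).+1 %/ M = q)%N by rewrite E divnMDl// divn_small// addn0.
  have -> : ((j + s).+1 %% M = t.+1)%N by rewrite E modnMDl modn_small.
  congr (_%:C%C * v 0 _); first by rewrite mulrA.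
  by apply/val_inj; rewrite /= !inordK// modn_small.
exists (fun j => c j * (if ((j + s) %% M == 0)%N then 2 else 1)).
  by move=> j; rewrite mulr_gt0//; case: ifP.
move=> v j; rewrite map_mxM mulmxA IH mul_jacobianL mulrA -rmorphM /= addn0.
by rewrite -val_eqE /= inordK// -!mulrA; case: ifP.
Qed.

(** X^m - 1 is separable in characteristic 0, so it has m distinct roots, and [has_prim_root] finds
    a primitive one among them. *)
Lemma closed_prim_root (C : numClosedFieldType) m :
  (0 < m)%N -> exists z : C, m.-primitive_root z.
Proof.
pose p : {poly C} := 'X^m - 1; have [r Dp] := closed_field_poly_normal p.
move=> m_gt0; rewrite (monicP _) ?monicXnsubC // scale1r in Dp.
have rn1 : all m.-unity_root r by apply/allP=> z; rewrite -root_prod_XsubC -Dp.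
have sz_r : (m < (size r).+1)%N.
  by rewrite -(size_prod_XsubC r id) -Dp size_XnsubC.
have [|z] := hasP (has_prim_root m_gt0 rn1 _ sz_r); last by exists z.
by rewrite -separable_prod_XsubC -Dp separable_Xn_sub_1// pnatr_eq0 -lt0n.
Qed.

Lemma eigenvalue_exists (C : closedFieldType) (A : 'M[C]_M) :
  exists z, eigenvalue A z.
Proof.
have [|z] := closed_rootP (char_poly A) _; last by exists z;
  rewrite eigenvalue_root_char.
by rewrite size_char_poly.
Qed.

Lemma real_specP k x : real_spec (bakerJn k x) <-> (M %| ones (itin k x))%N.
Proof.
have [c c0 Jc] := mul_bakerJn k x; set s := ones _ in Jc *.
set A := toC _ in Jc; rewrite /real_spec /spec.
have sign_neq0 t j : (-1) ^+ t * c j != 0.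
  by rewrite mulf_neq0 ?signr_eq0 ?gt_eqF.
split=> [rA|/dvdnP[q sq] z /eigenvalueP[v vA /rV0Pn[j vj]]]; last first.
  (* The rotation by s is trivial here, so z is the real diagonal entry at an index where the
     eigenvector does not vanish. *)
  exists ((-1) ^+ q * c j) => //=.
  have := Jc v j; rewrite vA mxE sq addnC divnMDl// divn_small// addn0.
  by rewrite modnMDl modn_small// inord_val => /(mulIf vj).
apply: contraT => sM;
  have [z /[dup] /rA[a _ az] /eigenvalueP[v vA v0]] := eigenvalue_exists A.
have /rV0Pn[i vi] := v0.
have zv j : z * v 0 j = ((-1) ^+ ((j + s) %/ M) * c j)%:C%C *
    v 0 (inord ((j + s) %% M)) by rewrite -Jc vA mxE.
have z0 : z != 0.
  (* The index l is i - s modulo M: if z = 0, the equation at l forces v to vanish at i. *)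
  apply: contraNneq vi => z0; pose l := inord ((i + s * M.-1) %% M) : 'I_M.
  have := zv l; rewrite z0 mul0r => /esym/eqP; rewrite mulf_eq0 fmorph_eq0.
  rewrite (negbTE (sign_neq0 _ _)) /= inordK ?ltn_pmod// modnDml -addnA -mulnSr.
  by rewrite addnC modnMDl modn_small// inord_val.
case: (boolP (M %| s + s)%N) => [/dvdnP[q sq]|s2].
  (* Two rotations by s return to i, so z squared is a product of two entries of the monomial
     matrix, whose sign is (-1)^q with 2s = qM. *)
  have : z * z * v 0 i = ((-1) ^+ ((i + s) %/ M) * c i *
      ((-1) ^+ (((i + s) %% M + s) %/ M) * c (inord ((i + s) %% M))))%:C%C
      * v 0 i.
    rewrite -mulrA zv mulrCA zv inordK ?ltn_pmod// modnDml -addnA sq.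
    by rewrite [(i + q * _)%N]addnC modnMDl (modn_small (ltn_ord i)) inord_val
      [LHS]mulrA -rmorphM.
  move/(mulIf vi); rewrite -az -rmorphM /= => /complexI aa.
  have : 0 <= a * a by rewrite -expr2 sqr_ge0.
  rewrite aa mulrACA -exprD leNgt => /negP[].
  have -> : ((i + s) %/ M + ((i + s) %% M + s) %/ M = q)%N.
    rewrite -(@divnMDl ((i + s) %/ M))// addnA -divn_eq -addnA sq addnC.
    by rewrite divnMDl// divn_small// addn0.
  have qo : odd q.
    apply: contraR sM => qe; apply/dvdnP; exists q./2.
    have := odd_double_half q; rewrite (negbTE qe) add0n -muln2 => qh.
    by move: sq; rewrite -{1}qh; lia.
  by rewrite -signr_odd qo expr1 mulN1r oppr_lt0 mulr_gt0.
have [w wP] := @closed_prim_root R[i] M isT.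
have w0 : w != 0.
  by apply/eqP => w0; move/eqP: (prim_expr_order wP);
    rewrite w0 expr0n eq_sym oner_eq0.
(* Conjugation by the diagonal matrix of the powers of w multiplies the matrix by w^s. *)
have ews : eigenvalue A (z * w ^+ s).
  apply/eigenvalueP; exists (\row_j (w ^+ j * v 0 j)); last first.
    by apply/rV0Pn; exists i; rewrite mxE mulf_neq0// expf_neq0.
  apply/rowP => j; rewrite Jc !mxE inordK ?ltn_pmod//.
  rewrite mulrCA -zv (prim_expr_mod wP) exprD.
  by rewrite [LHS]mulrACA [RHS]mulrACA [z * _]mulrC.
have [b _ bz] := rA _ ews.
have a0 : a != 0 by apply: contraNneq z0 => a0; rewrite -az a0.
have ws : w ^+ s = (b / a)%:C%C.
  apply: (mulfI z0); rewrite -bz -az -rmorphM /=; congr (_%:C%C).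
  by rewrite mulrCA divff ?mulr1.
(* A real number which is an M-th root of unity has square 1, so w^(2s) = 1 and M would divide
   2s. *)
have : `|b / a| ^+ M == 1.
  rewrite -normrX; suff -> : (b / a) ^+ M = 1 by rewrite normr1.
  by apply: complexI; rewrite rmorphXn /= -ws exprAC (prim_expr_order wP)
    expr1n.
rewrite pexprn_eq1//= => /eqP ba; case/negP: s2.
by rewrite (prim_order_dvd wP) exprD ws -rmorphM /= -expr2 -real_normK
  ?num_real// ba expr1n.
Qed.
End Spectrum.

(** * Inverse branches and periodic points *)

Section Branches.
Variables (R : realType) (n : nat).
Local Notation M := n.+2.
Local Notation X := (@bakerX R n).
Local Notation F := (@twisted_baker R n).
Implicit Types (x y : 'rV[R]_M) (u : seq bool) (i : 'I_M).

Lemma val_ordS i : i != ord_max -> ordS i = i.+1 :> nat.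
Proof.
move=> im; rewrite /= modn_small// ltn_neqAle ltn_ord andbT eqSS.
by apply: contra im => /eqP e; apply/eqP/val_inj.
Qed.

Lemma ordS_neq0 i : i != ord_max -> ordS i != ord0.
Proof. by move=> im; apply/eqP => /(congr1 (@nat_of_ord _));
  rewrite val_ordS. Qed.

Lemma ordSK i : i != ord_max -> inord (ordS i).-1 = i.
Proof. by move=> im; rewrite val_ordS//= inord_val. Qed.

Lemma inord_predK i : i != ord0 -> ordS (inord i.-1) = i.
Proof.
rewrite -lt0n => i0; have iM := ltn_ord i.
by apply/val_inj; rewrite /= inordK ?prednK ?modn_small//; lia.
Qed.

Lemma inord_pred_neq_max i : i != ord0 -> inord i.-1 != ord_max :> 'I_M.
Proof.
rewrite -lt0n => i0; have iM := ltn_ord i.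
by rewrite -val_eqE /= inordK; lia.
Qed.

(** The inverse of the affine map [branchE b] on the whole space. Its value need not lie on the side
    of the cut coded by b. *)
Definition branchI (b : bool) y : 'rV[R]_M :=
  if b then \row_i (if i == ord_max then (1 - y 0 ord0) / 2 else y 0 (ordS i))
  else \row_i (if i == ord0 then (y 0 ord0 - 1) / 2 else y 0 i).

Definition branchE (b : bool) : 'rV[R]_M -> 'rV[R]_M :=
  if b then @baker_affR R n else @baker_affL R n.

Lemma branchIK b y : branchE b (branchI b y) = y.
Proof.
apply/rowP => i; case: b; rewrite !mxE ?eqxx/=.
  case: eqVneq => [->|i0]; first by lra.
  by rewrite (negbTE (inord_pred_neq_max i0)) inord_predK.
by case: eqVneq => // ->; lra.
Qed.

Lemma branchEK b x : branchI b (branchE b x) = x.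
Proof.
apply/rowP => i; case: b; rewrite !mxE ?eqxx/=.
  case: eqVneq => [->|im]; first by lra.
  by rewrite (negbTE (ordS_neq0 im)) ordSK.
by case: eqVneq => // ->; lra.
Qed.

Lemma twisted_bakerE x : F x = branchE (0 <= x 0 ord0) x.
Proof. by rewrite /twisted_baker /baker_branch ltNge; case: (0 <= _). Qed.

Lemma branchI_X b y : X y -> X (branchI b y).
Proof.
move=> [/andP[y0 y1] yj]; case: b; split; rewrite ?mxE ?eqxx /=.
- have /andP[? ?] := yj (ordS ord0) isT.
  by apply/andP; split; lra.
- move=> j j0; rewrite mxE; case: ifPn => [_|jm]; first by apply/andP; split;
    lra.
  exact/yj/ordS_neq0.
- by apply/andP; split; lra.
- by move=> j j0; rewrite mxE (negbTE j0) yj.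
Qed.

Definition branches u y := foldr branchI y u.

Lemma branches_cat u v y : branches (u ++ v) y = branches u (branches v y).
Proof. exact: foldr_cat. Qed.

Lemma branches_X u y : X y -> X (branches u y).
Proof. by elim: u => //= b u IH /IH; exact: branchI_X. Qed.

Lemma branches_itin k x : branches (itin k x) (iter k F x) = x.
Proof.
elim: k x => [//|k IH] x; rewrite iterSr /= IH twisted_bakerE; exact: branchEK.
Qed.

Lemma branchI_dist b x y i : `|branchI b x 0 i - branchI b y 0 i| =
  if b then if i == ord_max then `|x 0 ord0 - y 0 ord0| / 2
            else `|x 0 (ordS i) - y 0 (ordS i)|
  else if i == ord0 then `|x 0 ord0 - y 0 ord0| / 2 else `|x 0 i - y 0 i|.
Proof.
have half (a : R) : `|a| / 2 = `|a / 2| by rewrite normrM [X in _ = _ *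
  X]gtr0_norm.
case: b; rewrite !mxE; case: ifP => // _; rewrite half.
  by rewrite distrC; congr `|_|; field.
by congr `|_|; field.
Qed.

(* A coordinate is halved each time it is moved through the last position. *)
Lemma branches_dist u x y D : (forall i, `|x 0 i - y 0 i| <= D) ->
  forall i, `|branches u x 0 i - branches u y 0 i|
    <= D * 2^-1 ^+ ((ones u + i) %/ M).
Proof.
move=> xyD; elim: u => [|b u IH] i.
  by rewrite /= add0n divn_small// mulr1.
rewrite /= branchI_dist; case: b => /=.
  case: ifPn => [/eqP ->|im].
    rewrite -[(1 + _ + _)%N]/((count id u).+1 + n.+1)%N addSnnS divnDr// divnn
      addn1.
    rewrite exprSr mulrA ler_wpM2r//.
    by have := IH ord0; rewrite addn0.
  by have := IH (ordS i); rewrite val_ordS// addnS -addSn.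
case: ifPn => [/eqP ->|_]; last exact: IH.
by apply: le_trans (IH ord0); rewrite ler_pdivrMr// ler_peMr// ler1n.
Qed.

(** Each inverse branch halves exactly one coordinate difference and permutes the others. For
    opposite corners of X this gives the volume of the image box. *)
Lemma prod_branches_dist u x y :
  \prod_i `|branches u x 0 i - branches u y 0 i| =
  2^-1 ^+ size u * \prod_i `|x 0 i - y 0 i|.
Proof.
elim: u => [|b u IH]; first by rewrite mul1r.
rewrite exprS -mulrA -IH /=; set p := branches u x; set q := branches u y.
under eq_bigr do rewrite branchI_dist.
case: b.
  rewrite big_ord_recr /= eqxx mulrC mulrAC [_ / _]mulrC; congr (_ * _).
  rewrite [RHS]big_ord_recl; congr (_ * _); apply: eq_bigr => i _.
  rewrite -val_eqE /= ltn_eqF//.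
  by have -> : ordS (widen_ord (leqnSn n.+1) i) = lift ord0 i;
    first by apply/val_inj; rewrite /= modn_small// ltnS.
by rewrite !big_ord_recl /= mulrAC [_ / _]mulrC.
Qed.

(** The right inverse branch has a nonnegative first coordinate, and the left one takes the value -1
    there only at points where it was already -1. *)
Lemma branches_stuck u y : X y -> branches u y 0 ord0 = -1 -> ones u = 0%N.
Proof.
move=> Xy; elim: u => [//|[] u IH] /=; rewrite mxE ?eqxx /=.
  have [_ /(_ (ordS ord0) isT)/andP[+ _]] := branches_X u Xy.
  by move=> p e; move: p; rewrite e lerNr oppr0 ler10.
by move=> e; apply: IH; lra.
Qed.

(* Once a coordinate equals 1, it moves with each right branch up to the last
   position and then to the value -1 of the first coordinate, from which the
   right branch cannot be taken. *)
Lemma branches_boundary u y i : X y ->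
  branches u y 0 i = 1 -> (i + ones u <= M)%N.
Proof.
move=> Xy; elim: u i => [|[] u IH] i /=; rewrite ?mxE.
- by rewrite addn0 => _; rewrite ltnW.
- case: ifPn => [/eqP -> e|im /IH]; last by rewrite val_ordS// addnS -addSn.
  rewrite /ones /= -/(ones u) (branches_stuck Xy)//; last by lra.
  by rewrite /= addn0 addn1.
- case: ifPn => [/eqP -> e|_ /IH //].
  have [/andP[_ +] _] := branches_X u Xy; lra.
Qed.

(** Coordinates equal to 0 are allowed. At first coordinate 1 the left inverse branch would give 0,
    on the wrong side of the cut. The right inverse branch moves the second coordinate to the first
    place and turns -1 into a last coordinate 1, so these faces are excluded too. *)
Definition interior_pt x := [/\ X x, forall i, x 0 i != 1 & x 0 ord0 != -1].

Lemma branchI_interior b y : interior_pt y -> interior_pt (branchI b y).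
Proof.
move=> [Xy y1 ym]; have [/andP[yl yr] yj] := Xy.
split; [exact: branchI_X|move=> i|]; case: b; rewrite !mxE ?eqxx.
- by case: ifP => // _; apply: contra_neq ym => ?; lra.
- by case: ifP => // _; apply/eqP => ?; lra.
- by have /andP[? ?] := yj (ordS ord0) isT; apply/eqP => ?; lra.
- by apply: contra_neq ym => ?; lra.
Qed.

Lemma branches_interior u y : interior_pt y -> interior_pt (branches u y).
Proof. by move=> iy; elim: u => //= b u; exact: branchI_interior. Qed.

(** On interior points the sign of the first coordinate recovers the last applied letter, so the map
    undoes the inverse branches one by one. *)
Lemma itin_branches u y : interior_pt y ->
  itin (size u) (branches u y) = u /\ iter (size u) F (branches u y) = y.
Proof.
move=> iy; elim: u => [//|b u [IH1 IH2]].
rewrite [size _]/= iterSr /=.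
have e : (0 <= branchI b (branches u y) 0 ord0) = b.
  have [[/andP[zl zr] zj] z1 _] := branches_interior u iy.
  case: b; rewrite mxE ?eqxx.
    by have /andP[? _] := zj (ordS ord0) isT.
  by apply/negbTE; rewrite -ltNge; have := z1 ord0; rewrite neq_lt; lra.
by rewrite twisted_bakerE e branchIK IH1 IH2.
Qed.

Lemma norm_rV_le x (D : R) : 0 <= D -> (`|x| <= D) = [forall i, `|x 0 i| <= D].
Proof.
move=> D0; have -> : `|x| = mx_norm x by []; rewrite mx_normrE;
  apply/idP/forallP => [xD i|xD].
  by apply: le_trans xD; exact: (le_bigmax _ (fun ij => `|x ij.1 ij.2|) (0, i)).
by apply: bigmax_le => // -[j i] _ /=; rewrite ord1.
Qed.

(** With M right letters the exponent in [branches_dist] is at least 1 for every coordinate. *)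
Lemma branches_lipschitz u x y : (M <= ones u)%N ->
  `|branches u x - branches u y| <= 2^-1 * `|x - y|.
Proof.
move=> Mu; rewrite norm_rV_le ?mulr_ge0//; apply/forallP => i; rewrite !mxE.
have /branches_dist/(_ i) : forall i, `|x 0 i - y 0 i| <= `|x - y|.
  move=> j; have := lexx `|x - y|; rewrite {1}norm_rV_le// => /forallP/(_ j).
  by rewrite !mxE.
move=> /(_ u)/le_trans; apply; rewrite mulrC ler_wpM2r//.
rewrite -[leRHS]expr1 ler_wiXn2l//; first by rewrite invf_le1// ler1n.
by rewrite divn_gt0// (leq_trans Mu)// leq_addr.
Qed.

(** * Fixed points of inverse branches and the coding of periodic points *)

Definition repeat u t := flatten (nseq t u).

Lemma ones_cat u v : ones (u ++ v) = (ones u + ones v)%N.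
Proof. exact: count_cat. Qed.

Lemma ones_repeat u t : ones (repeat u t) = (t * ones u)%N.
Proof. by elim: t => //= t IH; rewrite ones_cat IH mulSn. Qed.

Lemma repeat_comm u t : repeat u t ++ u = u ++ repeat u t.
Proof. by elim: t => [|t IH]; rewrite ?cats0//= -catA IH. Qed.

Lemma branches_repeat u t x : branches u x = x -> branches (repeat u t) x = x.
Proof. by move=> ux; elim: t => //= t IH; rewrite branches_cat IH. Qed.

(** A word with few right letters need not contract in the norm, but its M-fold repetition has at
    least M of them and does. *)
Lemma branches_fix_unique u x y : (0 < ones u)%N ->
  branches u x = x -> branches u y = y -> x = y.
Proof.
move=> u0 ux uy.
have Mu : (M <= ones (repeat u M))%N by rewrite ones_repeat leq_pmulr.
have := branches_lipschitz x y Mu; rewrite !branches_repeat// => xy.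
apply/subr0_eq/normr0_eq0; have := normr_ge0 (x - y); lra.
Qed.

Lemma compact_bakerX : compact X.
Proof.
rewrite bakerX_box.
have -> : rV_box (fun j : 'I_M => if j == ord0 then -1 else 0) (fun=> 1) =
    [set v : 'rV[R]_M | forall i, `[(if i == ord0 then -1 else 0 : R),
      1]%classic (v ord0 i)].
  by apply/seteqP; split => v /= vb i; have := vb i; rewrite /= in_itv.
exact (@rV_compact R M (fun i => `[if i == ord0 then -1 else 0, 1]%classic)
  (fun i => @segment_compact R _ _)).
Qed.

Lemma branches_fix_exists u : (0 < ones u)%N ->
  exists2 x, X x & branches u x = x.
Proof.
move=> u0.
have Mu : (M <= ones (repeat u M))%N by rewrite ones_repeat leq_pmulr.
have gX : {homo branches (repeat u M) : x / X x >-> X x} by exact: branches_X.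
pose V : completeNormedModType R := HB.pack 'rV[R]_M
  (Uniform_isComplete.Build 'rV[R]_M (@cauchy_cvg 'rV[R]_M)).
have q : @is_contraction R V V X X (mkfun gX).
  exists (2^-1)%:nng; split; first by rewrite /= invf_lt1// ltr1n.
  by move=> [x y] _ /=; exact: branches_lipschitz.
have [||x Xx xfix] := @banach_fixed_point R V X _ q.
- exact: compact_closed compact_bakerX.
- by exists 0; split => [|j _]; rewrite mxE; apply/andP; split; lra.
have xE : branches (repeat u M) x = x by exact/esym.
(* The Banach fixed point of the repeated word is fixed by u itself: its image under u is again
   fixed by the repetition, and uniqueness applies. *)
exists x => //; apply: (branches_fix_unique (u := repeat u M)) => //.
  exact: leq_trans Mu.
by rewrite -branches_cat repeat_comm branches_cat xE.
Qed.

(* Only meaningful if 0 < ones u: an arbitrary fixed point, or 0, otherwise. *)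
Definition coded_pt u : 'rV[R]_M := xget 0 [set x | X x /\ branches u x = x].

Lemma coded_pt_X u : X (coded_pt u).
Proof.
rewrite /coded_pt; case: xgetP => [x -> []//|_].
by split => [|j _]; rewrite mxE; apply/andP; split; lra.
Qed.

Lemma branches_coded_pt u : (0 < ones u)%N ->
  branches u (coded_pt u) = coded_pt u.
Proof.
move=> u0; have [x Xx xu] := branches_fix_exists u0.
by rewrite /coded_pt; case: xgetP => [y -> []//|/(_ x)[]].
Qed.

(** The point is also fixed by the (M+1)-fold repetition. This has more than M right letters, which
    [branches_boundary] forbids for a coordinate 1 (even at index 0) and [branches_stuck] for a
    first coordinate -1. *)
Lemma coded_pt_interior u : (0 < ones u)%N -> interior_pt (coded_pt u).
Proof.
move=> u0; have Xp := coded_pt_X u.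
have Mu : (M < ones (repeat u M.+1))%N by rewrite ones_repeat leq_pmulr.
have := branches_coded_pt u0 => /(branches_repeat M.+1) pE.
split => // [i|]; apply/eqP => p1.
  have := branches_boundary (u := repeat u M.+1) (i := i) Xp.
  by rewrite pE => /(_ p1); lia.
have := branches_stuck (u := repeat u M.+1) Xp.
by rewrite pE => /(_ p1); lia.
Qed.

Lemma itin_coded_pt u : (0 < ones u)%N -> itin (size u) (coded_pt u) = u.
Proof.
move=> u0; have [+ _] := itin_branches u (coded_pt_interior u0).
by rewrite branches_coded_pt.
Qed.

(** All-left words contract the first coordinate towards -1. Their fixed points in X thus lie in
    [bakerN], which is why periodic points outside it have a right letter. *)
Lemma branches_left u y : ones u = 0%N ->
  branches u y 0 ord0 + 1 = 2^-1 ^+ size u * (y 0 ord0 + 1).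
Proof.
elim: u => [|[] u IH]//=; first by rewrite mul1r.
by move/IH => e; rewrite mxE eqxx exprS -mulrA -e; field.
Qed.

Lemma baker_fix_itin k x : (0 < k)%N -> baker_fix k x ->
  (0 < ones (itin k x))%N /\ x = coded_pt (itin k x).
Proof.
move=> k0 [[Xx xN] xk].
have xE : branches (itin k x) x = x by rewrite -{2}xk branches_itin.
have u0 : (0 < ones (itin k x))%N.
  rewrite lt0n; apply/eqP => u0; apply: xN; split => //.
  have := branches_left x u0; rewrite xE size_itin => e.
  have : (2^-1 : R) ^+ k < 1 by rewrite exprn_ilt1 -?lt0n// invf_lt1// ltr1n.
  have [/andP[x1 _] _] := Xx; nra.
split => //; exact: branches_fix_unique u0 xE (branches_coded_pt u0).
Qed.

Lemma coded_pt_fix u : (0 < ones u)%N -> baker_fix (size u) (coded_pt u).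
Proof.
move=> u0; have ip := coded_pt_interior u0; have [Xp _ pm] := ip.
split; first by split => // -[_] /eqP; rewrite (negbTE pm).
by have [_] := itin_branches u ip; rewrite branches_coded_pt.
Qed.

(** * Periodic points with real and non-real spectrum as coded points, and averages over them *)

Lemma baker_fixRE k : (0 < k)%N -> @baker_fixR R n k = [set` [seq coded_pt u |
  u <- words k & (0 < ones u)%N && (M %| ones u)%N]].
Proof.
move=> k0; apply/seteqP; split => x /=.
  move=> [/(baker_fix_itin k0)[u0 xE] /real_specP Mu]; rewrite xE.
  by apply: map_f; rewrite mem_filter u0 Mu mem_words size_itin eqxx.
move=> /mapP[u]; rewrite mem_filter mem_words => /andP[/andP[u0 Mu] /eqP uk] ->.
rewrite -uk; split; first exact: coded_pt_fix.
by apply/real_specP; rewrite itin_coded_pt.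
Qed.

Lemma baker_fixCE k : (0 < k)%N -> @baker_fixC R n k = [set` [seq coded_pt u |
  u <- words k & (0 < ones u)%N && ~~ (M %| ones u)%N]].
Proof.
move=> k0; apply/seteqP; split => x /=.
  move=> [/(baker_fix_itin k0)[u0 xE]] /real_specP/negP Mu; rewrite xE.
  by apply: map_f; rewrite mem_filter u0 Mu mem_words size_itin eqxx.
move=> /mapP[u]; rewrite mem_filter mem_words => /andP[/andP[u0 Mu] /eqP uk] ->.
rewrite -uk; split; first exact: coded_pt_fix.
by move/real_specP; rewrite itin_coded_pt//; exact/negP.
Qed.

Lemma set_average_seq (T : choiceType) (s : seq T) (phi : T -> R) : uniq s ->
  set_average [set` s] phi = (size s)%:R^-1 * \sum_(x <- s) phi x.
Proof.
move=> us; have su : perm_eq (fset_set [set` s]) s.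
  apply: uniq_perm => // x; rewrite in_fset_set; last exact: finite_seq.
  by apply/idP/idP; rewrite inE.
by rewrite /set_average (perm_size su) (perm_big _ su).
Qed.

(** The coding is injective, as the itinerary of the point recovers the word, and the factors 2^-k
    cancel in the quotient. *)
Lemma coded_pt_average k (P : pred nat) (phi : 'rV[R]_M -> R) :
  set_average [set` [seq coded_pt u |
    u <- words k & (0 < ones u)%N && P (ones u)]] phi
  = wavg k (fun u => ((0 < ones u)%N && P (ones u))%:R * phi (coded_pt u)) /
    wavg k (fun u => ((0 < ones u)%N && P (ones u))%:R).
Proof.
rewrite set_average_seq; last first.
  rewrite map_inj_in_uniq ?filter_uniq ?uniq_words// => u v.
  rewrite !mem_filter !mem_words => /andP[/andP[u0 _] /eqP uk].
  move=> /andP[/andP[v0 _] /eqP vk] uv.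
  by rewrite -(itin_coded_pt u0) uk uv -vk itin_coded_pt.
rewrite big_map big_filter size_map size_filter /wavg.
have c0 : (2^-1 ^+ k : R) != 0 by rewrite expf_neq0// invr_eq0.
rewrite invfM mulrACA divff// mul1r mulrC; congr (_ * _).
  by rewrite big_mkcond; apply: eq_bigr => u _; case: ifP;
    rewrite (mul1r, mul0r).
by congr (_^-1); rewrite -sum1_count natr_sum big_mkcond;
  apply: eq_bigr => u _; case: ifP.
Qed.

End Branches.

(** * Cylinders and integrals *)

(** Heine-Cantor on a compact set, from compactness in its near-covering form. *)
Lemma continuous_unif_compact (R : realType) (V : normedModType R) (K : set V)
    (f : V -> R) : compact K -> {within K, continuous f} ->
  forall e, 0 < e -> exists2 d, 0 < d &
    forall x y, K x -> K y -> `|x - y| < d -> `|f x - f y| < e.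
Proof.
move=> cK cf e e0.
pose P (d : R) x := forall y, K y -> `|x - y| < d -> `|f x - f y| < e.
have /compact_near_coveringP/near_covering_withinP cov := cK.
have /cov : forall x, K x -> \forall x' \near x & d \near 0^'+, K x' -> P d x'.
  move=> x Kx; have e2 : 0 < e / 2 by rewrite divr_gt0.
  have /subspace_continuousP/(_ x Kx)/cvgrPdist_lt/(_ _ e2) := cf.
  rewrite /within /= => /nbhs_ballP[r /= r0 rf].
  have r2 : 0 < r / 2 by rewrite divr_gt0.
  exists (ball x (r / 2), [set d | d < r / 2]).
    by split; [exact: nbhsx_ballx|exact: nbhs_right_lt].
  move=> [x' d] /= [xx' dr] Kx' y Ky x'y.
  have xy : `|x - y| < r.
    move: xx'; rewrite -ball_normE /= => xx'.
    have := ler_distD x' x y; lra.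
  have := rf x'; have := rf y; rewrite -!ball_normE /= => /(_ xy Ky) fy.
  have xr : `|x - x'| < r by move: xx'; rewrite -ball_normE /=; lra.
  move=> /(_ xr Kx') fx; have := ler_distD (f x) (f x') (f y).
  by rewrite (distrC (f x') (f x)); lra.
move=> near0; near (0 : R)^'+ => d; exists d; first by near: d;
  exact: nbhs_right_gt.
move=> x y Kx Ky xy; have Kd : K `<=` P d by near: d.
exact: Kd Kx y Ky xy.
Unshelve. all: by end_near. Qed.

Lemma continuous_rV (R : realType) (T : topologicalType) m (f : T -> 'rV[R]_m) :
  (forall i, continuous (fun x => f x 0 i)) -> continuous f.
Proof.
move=> cf x A [P nP sPA]; rewrite nbhs_simpl /=.
have : \forall y \near x, forall i, P 0 i (f y 0 i).
  apply: filter_forall => i; exact: cf (nP 0 i).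
by apply: filterS => y Py; apply: sPA => i j; rewrite ord1.
Qed.

Lemma Rintegral_bigsetU d (T : measurableType d) (R : realType)
    (mu : {measure set T -> \bar R}) (I : eqType) (s : seq I) (C : I -> set T)
    (f : T -> R) :
  (forall i, measurable (C i)) -> uniq s -> trivIset [set` s] C ->
  mu.-integrable (\big[setU/set0]_(i <- s) C i) (EFin \o f) ->
  \int[mu]_(x in \big[setU/set0]_(i <- s) C i) f x =
  \sum_(i <- s) \int[mu]_(x in C i) f x.
Proof.
move=> mC us tC fi; rewrite /Rintegral integral_bigsetU_EFin//;
  last exact: measurable_int fi.
rewrite [X in fine X]big_seq [RHS]big_seq sum_fine// => i is_;
  apply: integrable_fin_num => //.
apply: integrableS fi => //; first exact: bigsetU_measurable.
by move=> x Cx; rewrite (big_rem i is_) /=; left.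
Qed.

Lemma measurable_within (R : realType) n (D : set (borelRV R n))
    (f : 'rV[R]_n -> R) : measurable D ->
  {within (D : set 'rV[R]_n), continuous f} ->
  measurable_fun D (f : borelRV R n -> measurableTypeR R).
Proof.
move=> mD cf; have := @measurability _ _ (borelRV R n) (measurableTypeR R) D
  f (@measurable_realfun.RGenOpens.G R).
apply; first exact: measurable_realfun.RGenOpens.measurableE.
move=> _ [V [a [b ->]] <-].
have oab : open `]a, b[%classic by exact: interval_open.
have /continuousP/(_ _ oab)/open_subspaceP[U oU UE] := cf.
rewrite setIC -UE; apply: measurableI => //.
exact: sub_sigma_algebra.
Qed.

(** * Measures of cylinders and means over them *)

Section Cylinders.
Variables (R : realType) (n : nat).
Local Notation M := n.+2.
Local Notation X := (@bakerX R n).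
Local Notation F := (@twisted_baker R n).
Local Notation mX := (@baker_measure R n).
Implicit Types (x y : 'rV[R]_M) (u : seq bool) (i : 'I_M).

Lemma continuous_branchE b : continuous (@branchE R n b).
Proof.
have cc i : continuous (fun x : 'rV[R]_M => x 0 i) by exact: coord_continuous.
apply: continuous_rV => i.
have c2 (a c : R) j : continuous (fun x : 'rV[R]_M => a + c * x 0 j).
  by move=> x;
    apply: (@continuousD R _ _ (cst a) (fun x : 'rV[R]_M => c * x 0 j));
    [exact: cst_continuous|apply: (@continuousM _ _ (cst c));
      [exact: cst_continuous|exact: cc]].
case: b => /=.
  rewrite (_ : (fun _ => _) = if i == ord0
    then (fun x : 'rV[R]_M => 1 + -2 * x 0 ord_max)
    else (fun x : 'rV[R]_M => x 0 (inord i.-1))); first by case: ifP.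
  by apply/funext => x; rewrite mxE; case: ifP; rewrite ?mulNr.
rewrite (_ : (fun _ => _) = if i == ord0
  then (fun x : 'rV[R]_M => 1 + 2 * x 0 ord0)
  else (fun x : 'rV[R]_M => x 0 i)); first by case: ifP.
by apply/funext => x; rewrite mxE; case: ifP.
Qed.

Definition cylinder u : set (borelRV R M) :=
  [set x : 'rV[R]_M | X x /\ itin (size u) x = u].

(** The discontinuous map is replaced, on each side of the cut, by its affine branch, so that
    preimages are taken under continuous maps. *)
Lemma measurable_cylinder u : measurable (cylinder u).
Proof.
elim: u => [|b u IH].
  rewrite (_ : cylinder [::] = X); first exact: measurable_bakerX.
  by apply/seteqP; split=> x // [].
have -> : cylinder (b :: u) = X `&`
   ((fun x : 'rV[R]_M => x 0 ord0) @^-1`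
     (if b then `[0, +oo[ else `]-oo, 0[)%classic `&`
    branchE b @^-1` cylinder u).
  have bE x : (0 <= x 0 ord0) = b <->
      (if b then `[0, +oo[ else `]-oo, 0[)%classic (x 0 ord0).
    case: b {IH} => /=; rewrite in_itv/= ?andbT//.
    by rewrite ltNge; split=> [->|/negbTE].
  apply/seteqP; split => x /=.
    move=> [Xx [xb ue]]; split => //; split; first exact/bE.
    split; last by move: ue; rewrite twisted_bakerE xb.
    by rewrite -xb -twisted_bakerE; exact: twisted_bakerX.
  move=> [Xx [/bE xb [_ ub]]]; split => //=; rewrite xb twisted_bakerE xb.
  by rewrite ub.
apply: measurableI; first exact: measurable_bakerX.
apply: measurableI.
  rewrite -[X in measurable X]setTI; apply: measurable_rV_coord => //.
  by case: b.
rewrite -[X in measurable X]setTI.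
exact: (continuous_measurable_borel (@continuous_branchE b)).
Qed.

Definition corner_lo : 'rV[R]_M := \row_i (if i == ord0 then -1 else 0).
Definition corner_hi : 'rV[R]_M := const_mx 1.

(** Each coordinate of an inverse branch is a monotone function of one coordinate of its argument.
    The right branch reverses the order in one of them, hence [Num.min] and [Num.max]. *)
Lemma branches_between u x i : X x ->
  let a := branches u corner_lo 0 i in let b := branches u corner_hi 0 i in
  Num.min a b <= branches u x 0 i <= Num.max a b.
Proof.
move=> Xx /=; elim: u i => [|b u IH] i /=.
  rewrite !mxE; have [x0 xj] := Xx; have [->|i0] := eqVneq i ord0.
    by rewrite min_l ?max_r//; lra.
  by rewrite min_l ?max_r ?xj//; lra.
case: b; rewrite !mxE; case: ifP => // _; have := IH ord0;
  set a := branches u corner_lo _ _; set b := branches u corner_hi _ _;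
  set p := branches u x _ _; case: (leP a b) => ab /andP[ap pb].
- by rewrite min_r ?max_l; lra.
- by rewrite min_l ?max_r; lra.
- by rewrite min_l ?max_r; lra.
- by rewrite min_r ?max_l; lra.
Qed.

Lemma baker_measureE (A : set (borelRV R M)) : A `<=` X ->
  mX A = (2^-1%:E * lebesgue_rV A)%E.
Proof.
move=> AX; rewrite /baker_measure /= /mscale /= /mrestr.
by rewrite lebesgue_bakerX/= setIidl.
Qed.

Lemma Rintegral_baker1 : \int[mX]_(x in X) 1 = 1 :> R.
Proof.
rewrite Rintegral_cst; last exact: measurable_bakerX.
rewrite mul1r baker_measureE; last by [].
by rewrite lebesgue_bakerX -EFinM mulVf.
Qed.

(** The cylinder lies in the box spanned by the images of two opposite corners of X. Its volume is 2
    * 2^-|u| by [prod_branches_dist], and normalization removes the 2. *)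
Lemma cylinder_le u : (mX (cylinder u) <= (2^-1 ^+ size u)%:E)%E.
Proof.
pose a i := branches u corner_lo 0 i; pose b i := branches u corner_hi 0 i.
pose B := @rV_box R M (fun i => Num.min (a i) (b i))
  (fun i => Num.max (a i) (b i)).
rewrite baker_measureE; last by move=> x [].
apply: (@le_trans _ _ (2^-1%:E * lebesgue_rV B)%E).
  apply: lee_wpmul2l; first by rewrite lee_fin invr_ge0.
  apply: le_measure; rewrite ?inE;
    [exact: measurable_cylinder|exact: measurable_rV_box|].
  move=> x [Xx ux] i; have := branches_itin (size u) x; rewrite ux => <-.
  apply: branches_between; elim: (size u) => //= k; exact: twisted_bakerX.
rewrite lebesgue_rV_box => [|i]; last by rewrite ge_min le_max lexx.
rewrite -EFinM lee_fin.
have -> : \prod_i (Num.max (a i) (b i) - Num.min (a i) (b i)) =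
    \prod_i `|branches u corner_lo 0 i - branches u corner_hi 0 i|.
  apply: eq_bigr => i _; rewrite -/(a i) -/(b i).
  by case: (leP (a i) (b i)) => ab; [rewrite distrC|];
    rewrite ger0_norm ?subr_ge0// ltW.
rewrite prod_branches_dist big_ord_recl big1 => [|i _]; rewrite !mxE.
  rewrite eqxx mulr1 (_ : `|-1 - 1| = 2 :> R); last by rewrite ler0_norm; lra.
  by rewrite mulrC -mulrA divff// mulr1.
by rewrite (_ : lift ord0 i == ord0 = false)// sub0r normrN normr1.
Qed.

Lemma bigcup_cylinder k : \big[setU/set0]_(u <- words k) cylinder u = X.
Proof.
rewrite -bigcup_seq; apply/seteqP; split=> [x [u _ []]//|x Xx].
exists (itin k x); first by rewrite /= mem_words size_itin.
by split; rewrite ?size_itin.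
Qed.

Lemma trivIset_cylinder k : trivIset [set` words k] cylinder.
Proof.
move=> u v /=; rewrite !mem_words => /eqP uk /eqP vk [x [[_ <-] [_ <-]]].
by rewrite uk vk.
Qed.

Lemma sum_Rintegral_cylinder k (phi : 'rV[R]_M -> R) :
  mX.-integrable X (EFin \o phi) ->
  \sum_(u <- words k) \int[mX]_(x in cylinder u) phi x =
  \int[mX]_(x in X) phi x.
Proof.
move=> phi_int; rewrite -(bigcup_cylinder k) [RHS]Rintegral_bigsetU//.
- exact: measurable_cylinder.
- exact: uniq_words.
- exact: trivIset_cylinder.
- by rewrite bigcup_cylinder.
Qed.

Lemma baker_measure_fin (A : set (borelRV R M)) :
  measurable A -> (mX A < +oo)%E.
Proof.
move=> mA; apply: (@le_lt_trans _ _ 1%E); last exact: ltry.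
rewrite -[leRHS](@baker_measureT R n); apply: le_measure; rewrite ?inE//.
Qed.

Lemma integrable_baker_cst (A : set (borelRV R M)) (c : R) : measurable A ->
  mX.-integrable A (EFin \o cst c).
Proof.
move=> mA; apply: measurable_bounded_integrable => //;
  first exact: baker_measure_fin.
by exists `|c|; split => // r rc x _; exact: ltW.
Qed.

(** The 2^k cylinders of length k partition X, which has measure 1, and each has measure at most
    2^-k; so all these bounds are equalities. *)
Lemma measure_cylinder u : fine (mX (cylinder u)) = 2^-1 ^+ size u.
Proof.
set k := size u.
have mle v : v \in words k -> 0 <= 2^-1 ^+ k - fine (mX (cylinder v)).
  rewrite mem_words => /eqP vk;
    rewrite subr_ge0 -vk -lee_fin fineK ?cylinder_le//.
  by rewrite ge0_fin_numE//; apply: baker_measure_fin;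
    exact: measurable_cylinder.
have : \sum_(v <- words k) (2^-1 ^+ k - fine (mX (cylinder v))) = 0.
  rewrite sumrB; apply/eqP; rewrite subr_eq0; apply/eqP.
  have -> : \sum_(v <- words k) (2^-1 : R) ^+ k = 1.
    by have := @wavg_cst R k 1; rewrite /wavg mulr_sumr;
      under eq_bigr do rewrite mulr1.
  have := sum_Rintegral_cylinder k
    (integrable_baker_cst 1 (@measurable_bakerX R n)).
  rewrite Rintegral_baker1 => <-; apply: eq_bigr => v _.
  by rewrite Rintegral_cst ?mul1r//; exact: measurable_cylinder.
move/eqP; rewrite big_seq psumr_eq0 => [/allP/(_ u)|v]; last exact: mle.
by rewrite mem_words eqxx => /(_ isT) /eqP e; apply/esym/subr0_eq.
Qed.

(** The factor 2^|u| is the inverse of the measure of the cylinder, so the first term is the mean of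
    [phi] over it. *)
Lemma cylinder_mean u (phi : 'rV[R]_M -> R) c e :
  mX.-integrable X (EFin \o phi) ->
  (forall x, cylinder u x -> `|phi x - c| <= e) ->
  `|2 ^+ size u * \int[mX]_(x in cylinder u) phi x - c| <= e.
Proof.
move=> phi_int pc; have mC := measurable_cylinder u.
have ui : mX.-integrable (cylinder u) (EFin \o phi).
  apply: integrableS phi_int => //; first exact: measurable_bakerX.
  by move=> x [].
have ci d := integrable_baker_cst d mC.
have di : mX.-integrable (cylinder u) (EFin \o (fun x => phi x - c)).
  rewrite (_ : _ \o _ = (EFin \o phi) \- (EFin \o cst c))%E; last by [].
  exact: integrableB.
have : `|\int[mX]_(x in cylinder u) (phi x - c)| <= e * 2^-1 ^+ size u.
  apply: (le_trans (le_normr_Rintegral mC di)).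
  rewrite -measure_cylinder -Rintegral_cst//; apply: le_Rintegral => //.
    exact: integrable_norm di.
  exact: ci.
rewrite (@RintegralB _ _ _ mX _ phi (cst c))//
  Rintegral_cst// measure_cylinder => H.
rewrite -(ler_pM2r (x := 2^-1 ^+ size u)) ?exprn_gt0 ?invr_gt0//.
apply: le_trans H; rewrite -[X in _ * X]ger0_norm ?exprn_ge0 ?invr_ge0//
  -normrM.
by rewrite mulrBl mulrAC -exprMn divff// expr1n mul1r.
Qed.

Lemma integrable_baker (phi : 'rV[R]_M -> R) : {within X, continuous phi} ->
  mX.-integrable X (EFin \o phi).
Proof.
move=> cphi; have mX := @measurable_bakerX R n.
apply: measurable_bounded_integrable => //; first exact: baker_measure_fin.
  exact: measurable_within.
have := continuous_compact cphi (@compact_bakerX R n)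
  => /compact_bounded[B [Br BP]].
by exists B; split => // r /BP rP x Xx; apply: rP; exists x.
Qed.

End Cylinders.

(** * Equidistribution *)

Section Equidistribution.
Variables (R : realType) (n : nat).
Local Notation M := n.+2.
Local Notation X := (@bakerX R n).
Local Notation mX := (@baker_measure R n).
Implicit Types (phi : 'rV[R]_M -> R) (u v : seq bool).

Lemma bounded_baker phi : {within X, continuous phi} ->
  exists2 B, 0 < B & forall x, X x -> `|phi x| <= B.
Proof.
move=> cphi.
have := continuous_compact cphi (@compact_bakerX R n)
  => /compact_bounded[B [Br BP]].
exists (`|B| + 1); first by rewrite ltr_pwDr.
move=> x Xx; apply: (BP (`|B| + 1)); last by exists x.
by rewrite (le_lt_trans (ler_norm B))// ltrDl.
Qed.

Lemma bakerX_dist (x y : 'rV[R]_M) i : X x -> X y -> `|x 0 i - y 0 i| <= 2.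
Proof.
move=> [x0 xj] [y0 yj]; have [->|i0] := eqVneq i ord0; rewrite ler_norml;
  first by lra.
by have /andP[? ?] := xj i i0; have /andP[? ?] := yj i i0; lra.
Qed.

Lemma branches_small (d : R) : 0 < d -> exists2 m, (0 < m)%N &
  forall u x y, (m <= ones u)%N -> X x -> X y ->
    `|branches u x - branches u y| < d.
Proof.
move=> d0; have c1 : `|2^-1 : R| < 1 by rewrite ger0_norm ?invr_ge0//
  invf_lt1// ltr1n.
have d4 : 0 < d / 4 by rewrite divr_gt0.
have /cvgrPdist_le/(_ _ d4)[K _ /(_ K (leqnn _))] := cvg_expr c1.
rewrite sub0r normrN ger0_norm ?exprn_ge0 ?invr_ge0// => Kd.
(* K * M right letters halve every coordinate difference, at most 2, K times; the additional M keeps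
   the threshold positive when K = 0. *)
exists (K.+1 * M)%N => // u x y mu Xx Xy.
apply: (@le_lt_trans _ _ (2 * 2^-1 ^+ K)); last by lra.
rewrite norm_rV_le ?mulr_ge0 ?exprn_ge0 ?invr_ge0//; apply/forallP => i;
  rewrite !mxE.
apply: (le_trans (branches_dist u (fun j => bakerX_dist j Xx Xy) i)).
rewrite ler_wpM2l// ler_wiXn2l ?invr_ge0//; first by rewrite invf_le1// ler1n.
by rewrite leq_divRL//; apply: leq_trans (leq_addr _ _); apply: leq_trans mu;
  rewrite leq_mul2r leqnSn orbT.
Qed.

Lemma wavg_cylinder_mean k phi : mX.-integrable X (EFin \o phi) ->
  wavg k (fun u => 2 ^+ size u * \int[mX]_(x in cylinder u) phi x) =
  \int[mX]_(x in X) phi x.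
Proof.
move=> phi_int; rewrite -(sum_Rintegral_cylinder k phi_int) /wavg mulr_sumr.
rewrite big_seq [RHS]big_seq; apply: eq_bigr => u; rewrite mem_words => /eqP ->.
by rewrite mulrA -exprMn mulVf// expr1n mul1r.
Qed.

(* Splitting a long word into u v with u of fixed length, v equidistributes
   the number of ones modulo M whereas u determines the point up to a small
   error, unless it has few ones. *)
Lemma wavg_coded_pt_cvg phi (h : nat -> R) : {within X, continuous phi} ->
  (forall s, h (s + M)%N = h s) -> (forall s, 0 <= h s <= 1) ->
  wavg k (fun u => h (ones u) * phi (coded_pt R n u)) @[k --> \oo] -->
  (M%:R^-1 * \sum_(0 <= i < M) h i) * \int[mX]_(x in X) phi x.
Proof.
move=> cphi hM h01; set hb := _ * \sum_(0 <= i < M) h i.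
(* The errors below are e + 2Be from [T1] and eB from [T2], in total e (1 + 3B). *)
have phi_int := integrable_baker cphi; have [B B0 phiB] := bounded_baker cphi.
apply/cvgrPdist_le => e0 e0_gt0; pose e := e0 / (1 + 3 * B).
have B3 : 0 < 1 + 3 * B by lra.
have e_gt0 : 0 < e by rewrite divr_gt0.
have [d d0 phid] := continuous_unif_compact (@compact_bakerX R n) cphi e_gt0.
have [m m0 md] := branches_small d0.
(* The prefix length k is fixed so that the proportion of prefixes with fewer than m right letters
   is at most e. *)
have [k Qk] : exists k, 2 ^+ m * (3 / 4) ^+ k <= e.
  have c1 : `|3 / 4 : R| < 1 by rewrite ger0_norm; lra.
  have p0 : 0 < (2 : R) ^+ m by rewrite exprn_gt0.
  have em : 0 < e / 2 ^+ m by rewrite divr_gt0.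
  have /cvgrPdist_le/(_ _ em)[k _ /(_ k (leqnn _))] := cvg_expr c1.
  rewrite sub0r normrN => /(le_trans (ler_norm _)); rewrite ler_pdivlMr// mulrC.
  by exists k.
have [l0 _ hl0] := shift_avg_cvg (isT : (0 < M)%N) hM h01 e_gt0.
exists (k + l0)%N => // N /= kN.
have [l [l0l ->]] : exists l, (l0 <= l)%N /\ N = (k + l)%N.
  by exists (N - k)%N; lia.
have hl := hl0 l l0l; rewrite -/hb in hl.
pose J u := 2 ^+ size u * \int[mX]_(x in cylinder u) phi x.
have JB u : `|J u| <= B.
  rewrite -[J u]subr0; apply: cylinder_mean => // x [Xx _].
  by rewrite subr0 phiB.
(* The point coded by u v and all points of the cylinder of u are images under [branches u] of
   points of X, hence closer than d if u has m right letters. Otherwise both terms are bounded by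
   B. *)
have near_J u v : `|phi (coded_pt R n (u ++ v)) - J u|
    <= e + 2 * B * (ones u < m)%:R.
  have [um|um] := ltnP (ones u) m.
    apply: (le_trans (ler_normB _ _)).
    by rewrite /=; have := JB u; have := phiB _ (coded_pt_X R n (u ++ v)); lra.
  rewrite mulr0 addr0 distrC; apply: cylinder_mean => // x [Xx ux].
  apply/ltW/phid => //; first exact: coded_pt_X.
  have uv0 : (0 < ones (u ++ v))%N by rewrite ones_cat; lia.
  rewrite -(branches_coded_pt R n uv0) branches_cat.
  rewrite -(branches_itin (size u) x) ux; apply: md => //.
    by elim: (size u) => //= j; exact: twisted_bakerX.
  exact/branches_X/coded_pt_X.
(* For fixed u, [phi] at the coded point is replaced by the mean [J u], which leaves the average
   over v, and the weight h averages to [shift_avg]. *)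
have T1 : `|wavg (k + l) (fun u => h (ones u) * phi (coded_pt R n u)) -
    wavg k (fun u => shift_avg h l (ones u) * J u)| <= e + 2 * B * e.
  rewrite wavg_cat -wavgB; apply: (le_trans (ler_norm_wavg _ _)).
  apply: (@le_trans _ _ (wavg k (fun u => e + 2 * B * (ones u < m)%:R)));
    last first.
    rewrite wavgD wavg_cst wavgZ lerD2l; apply: ler_wpM2l;
      first by rewrite mulr_ge0// ltW.
    exact: le_trans (wavg_few_ones R k m) Qk.
  apply: ler_wavg => u _; rewrite (mulrC (shift_avg _ _ _)) -wavgZ -wavgB.
  apply: (le_trans (ler_norm_wavg _ _)).
  rewrite -[leRHS](wavg_cst l); apply: ler_wavg => v _.
  rewrite ones_cat [J u * _]mulrC -mulrBr normrM; apply: le_trans (near_J u v).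
  have /andP[hge hle] := h01 (ones u + ones v)%N.
  by rewrite ler_piMl// ger0_norm.
(* The suffix is long enough for [shift_avg] to be within e of the mean of h, whatever the number of
   right letters of u. *)
have T2 : `|wavg k (fun u => shift_avg h l (ones u) * J u) -
    hb * \int[mX]_(x in X) phi x| <= e * B.
  rewrite -(wavg_cylinder_mean k phi_int) -wavgZ -wavgB.
  apply: (le_trans (ler_norm_wavg _ _)); rewrite -[leRHS](wavg_cst k).
  apply: ler_wavg => u _; rewrite -mulrBl normrM.
  by rewrite ler_pM.
rewrite distrC; apply: (le_trans (ler_distD
  (wavg k (fun u => shift_avg h l (ones u) * J u)) _ _)).
apply: (le_trans (lerD T1 T2)).
have -> : e0 = e * (1 + 3 * B) by rewrite divfK// gt_eqF.
by lra.
Qed.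

(** Only the all-left word is removed. Its term g tends to 0 by [wavg_few_ones] with threshold 1,
    since [coded_pt] lies in X even for that word. *)
Lemma wavg_coded_pt_pos_cvg phi (P : pred nat) : {within X, continuous phi} ->
  (forall s, P (s + M)%N = P s) ->
  wavg k (fun u => ((0 < ones u)%N && P (ones u))%:R * phi (coded_pt R n u))
    @[k --> \oo] -->
  (M%:R^-1 * \sum_(0 <= i < M) (P i)%:R) * \int[mX]_(x in X) phi x.
Proof.
move=> cphi PM; have [B B0 phiB] := bounded_baker cphi.
pose f u := (P (ones u))%:R * phi (coded_pt R n u).
pose g u := ((ones u < 1)%N && P (ones u))%:R * phi (coded_pt R n u).
have fcvg : wavg k f @[k --> \oo] -->
    (M%:R^-1 * \sum_(0 <= i < M) (P i)%:R) * \int[mX]_(x in X) phi x.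
  apply: (wavg_coded_pt_cvg (h := fun s => (P s)%:R)) => // s;
    first by rewrite PM.
  by case: (P s); rewrite ?lexx ler01.
have gcvg : wavg k g @[k --> \oo] --> (0 : R).
  have c1 : `|3 / 4 : R| < 1 by rewrite ger0_norm; lra.
  have bcvg : (B * 2) * (3 / 4 : R) ^+ k @[k --> \oo] --> (0 : R).
    by rewrite -[0](mulr0 (B * 2)); apply: cvgMr; exact: cvg_expr.
  apply: norm_cvg0; apply: squeeze_cvgr bcvg; last exact: cvg_cst.
  apply: nearW => k; rewrite normr_ge0 /=;
    apply: (le_trans (ler_norm_wavg _ _)).
  rewrite -mulrA; apply: (@le_trans _ _
    (B * wavg k (fun u => (ones u < 1)%:R))).
    rewrite -wavgZ; apply: ler_wavg => u _; rewrite normrM.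
    case: ltnP => /= _; last by rewrite normr0 mul0r mulr0.
    have := phiB _ (coded_pt_X R n u).
    case: (P _) => pB; first by rewrite !mulr1n normr1 mul1r mulr1.
    by rewrite mulr0n normr0 mul0r mulr1n mulr1 ltW.
  apply: ler_wpM2l; first exact: ltW.
  by have := @wavg_few_ones R k 1; rewrite expr1.
rewrite -[X in _ --> X]subr0.
suff -> : (fun k => wavg k (fun u => ((0 < ones u)%N && P (ones u))%:R *
    phi (coded_pt R n u))) = (fun k => wavg k f - wavg k g) by exact: cvgB.
apply/funext => k; rewrite -wavgB; apply: eq_wavg => u _; rewrite /f /g -mulrBl.
by case: (ones u) => [|s]; rewrite ?subrr ?subr0.
Qed.

(** The average is a quotient whose denominator is the numerator for [phi] = 1. Both limits contain
    the density [hb] of the residues in P, which cancels because some residue satisfies P. *)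
Lemma set_average_cvg phi (P : pred nat) (A : nat -> set 'rV[R]_M) :
  {within X, continuous phi} ->
  (forall s, P (s + M)%N = P s) -> (exists2 i, (i < M)%N & P i) ->
  (forall k, (0 < k)%N -> A k = [set` [seq coded_pt R n u |
    u <- words k & (0 < ones u)%N && P (ones u)]]) ->
  set_average (A k) phi @[k --> \oo] --> \int[mX]_(x in X) phi x.
Proof.
move=> cphi PM [i iM Pi] AE; set I := \int[mX]_(x in _) _.
set hb := M%:R^-1 * \sum_(0 <= i < M) (P i)%:R : R.
have hb0 : hb != 0.
  rewrite mulf_neq0// ?invr_eq0 ?pnatr_eq0// -natr_sum pnatr_eq0 -lt0n.
  by rewrite big_mkord (bigD1 (Ordinal iM))//= Pi.
have c1 : {within X, continuous (fun=> 1 : R)} by exact: cst_continuous.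
have num := wavg_coded_pt_pos_cvg cphi PM.
have := wavg_coded_pt_pos_cvg c1 PM; rewrite Rintegral_baker1 mulr1 -/hb => den.
rewrite -[I](mulKf hb0) mulrC.
have q := cvgM num (cvgV hb0 den).
refine (cvg_trans _ (q _ _)); apply: near_eq_cvg; near=> k.
rewrite AE; last by near: k; exists 1%N.
rewrite coded_pt_average /=; congr (_ / _); apply: eq_wavg => u _.
by rewrite mulr1.
Unshelve. all: by end_near. Qed.

End Equidistribution.

Theorem theoremC (R : realType) (n : nat) (phi : 'rV[R]_n.+2 -> R)
    (phi_cont : {within @bakerX R n, continuous phi}) :
  (set_average (@baker_fixR R n k) phi @[k --> \oo] -->
     \int[@baker_measure R n]_(x in @bakerX R n) phi x) /\
  (set_average (@baker_fixC R n k) phi @[k --> \oo] -->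
     \int[@baker_measure R n]_(x in @bakerX R n) phi x).
Proof.
split.
  apply: (set_average_cvg (P := fun s => n.+2 %| s)%N) => //.
  - by move=> s; rewrite dvdn_addl.
  - by exists 0%N.
  - exact: baker_fixRE.
apply: (set_average_cvg (P := fun s => ~~ (n.+2 %| s))%N) => //.
- by move=> s; rewrite dvdn_addl.
(* The residue 1 gives non-real spectrum because the dimension is at least 2. *)
- by exists 1%N; rewrite ?dvdn1.
- exact: baker_fixCE.
Qed.
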